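(* There is a universal constant $K>0$ such that the following holds. Let $d\in\mathbb{N}$, $1<c<\infty$ and $0<q<1$, and assume $d/\ln(2/q)\ge 2$. Then there exists $\tau$ with $0<\tau<1$ (depending on $d,c,q$) such that for every $p$ and every $(\tau d,\ c\tau d,\ p,\ q)$-sensitive hash family $\mathcal{H}$ for $\{0,1\}^d$ under Hamming distance, $$\rho(\mathcal{H})=\frac{\ln(1/p)}{\ln(1/q)}\ \ge\ \frac1c-\left(K\cdot\frac{\ln(2/q)}{d}\cdot\ln\!\left(\frac{d}{\ln(2/q)}\right)\right)^{1/3}.$$
   Context: A distance space $(X,\mathrm{dist})$ is a metric space in which the triangle inequality need not hold. Let $U$ be any finite or countably infinite set, $r>0$ and $c>1$. A hash family for $X$ is a probability distribution $\mathcal{H}$ over functions $h:X\to U$. It is $(r,cr,p,q)$-sensitive, where $q<p$, if for all $x,y\in X$: (i) $\mathrm{dist}(x,y)\le r$ implies $\Pr_{h\sim\mathcal{H}}[h(x)=h(y)]\ge p$; and (ii) $\mathrm{dist}(x,y)\ge cr$ implies $\Pr_{h\sim\mathcal{H}}[h(x)=h(y)]\le q$. The rho parameter of an $(r,cr,p,q)$-sensitive family is $\rho(\mathcal{H})=\ln(1/p)/\ln(1/q)$. The Hamming distance on $\{0,1\}^d$ is the number of coordinates in which two strings differ. *)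

(* Defs.v *)
From HB Require Import structures.
From mathcomp Require Import all_boot all_order all_algebra.
From mathcomp Require Import all_classical all_reals all_analysis.

Set Implicit Arguments.
Unset Strict Implicit.
Unset Printing Implicit Defensive.

Import Order.TTheory GRing.Theory Num.Theory.

Local Open Scope classical_set_scope.
Local Open Scope ring_scope.

Record distanceSpace (R : realType) := DistanceSpace {
  point_of :> Type;
  dist : point_of -> point_of -> R;
  dist_ge0 : forall x y, 0 <= dist x y;
  dist_eq0 : forall x y, dist x y = 0 <-> x = y;
  dist_sym : forall x y, dist x y = dist y x
}.

Section HammingCube.
Variables (R : realType) (d : nat).

Definition hamming (x y : {ffun 'I_d -> bool}) : nat :=
  #|[set i : 'I_d | x i != y i]%SET|.

Lemma hamming_eq0 (x y : {ffun 'I_d -> bool}) :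
  (hamming x y)%:R = 0 :> R <-> x = y.
Proof.
split=> [/eqP|->].
  rewrite pnatr_eq0 cards_eq0 => /eqP e; apply/ffunP => i.
  by move/setP/(_ i): e; rewrite !inE => /negbFE/eqP.
apply/eqP; rewrite pnatr_eq0 cards_eq0; apply/eqP/setP => i.
by rewrite !inE eqxx.
Qed.

Lemma hamming_sym (x y : {ffun 'I_d -> bool}) :
  (hamming x y)%:R = (hamming y x)%:R :> R.
Proof.
by congr (_%:R); apply: eq_card => i; rewrite !inE eq_sym.
Qed.

Definition hamming_cube : distanceSpace R :=
  @DistanceSpace R {ffun 'I_d -> bool} (fun x y => (hamming x y)%:R)
    (fun x y => ler0n R (hamming x y)) hamming_eq0 hamming_sym.

End HammingCube.

(* For countable U the cylinders {h | h x = u} generate the product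
   sigma-algebra on X -> U, which is the full power set when X is also finite.
   MathComp-Analysis requires measurable spaces to be pointed, whence the
   pointedType: an empty U carries no hash family on a nonempty X anyway. *)
Definition cylinders (X : Type) (U : pointedType) : set (set (X -> U)) :=
  [set A | exists x u, A = [set h | h x = u]].

Definition hash_function (X : Type) (U : pointedType) :=
  g_sigma_algebraType (@cylinders X U).

Definition hash_family (R : realType) (X : distanceSpace R) (U : pointedType) :=
  probability (hash_function X U) R.

Definition collision_prob (R : realType) (X : distanceSpace R) (U : pointedType)
    (H : hash_family X U) (x y : X) : \bar R :=
  H [set h : X -> U | h x = h y].

(* s plays the role of the far radius c r. *)
Definition sensitive (R : realType) (X : distanceSpace R) (U : pointedType)
    (r s p q : R) (H : hash_family X U) : Prop :=
  [/\ q < p,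
      forall x y : X, dist x y <= r -> (p%:E <= collision_prob H x y)%E
    & forall x y : X, s <= dist x y -> (collision_prob H x y <= q%:E)%E].

(* rho depends on a sensitive family only through its parameters p and q. *)
Definition rho (R : realType) (p q : R) : R := ln (1 / p) / ln (1 / q).

(* Main.v *)
(* Averaging the collision probability Pr[h x = h y] over all pairs with
   x + y = z gives a function of z with nonnegative Walsh coefficients w_S
   summing to 1. Evaluated at a random z whose bits are independently set with
   probability (1 - exp(-t)) / 2, its mean K t = sum_S w_S exp(-t |S|) is
   log-convex in t with K 0 = 1, so K (a s) <= (K s)^a for 0 <= a <= 1. The
   weight of z concentrates around d t / 2 for small t, hence K t is roughly at
   least p at the near radius and at most q at the far one, whose times t are
   in ratio about 1 / c. With s = e, a Chernoff bound for absolute deviations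
   e^2 d has failure probability exp(- d e^3 / 4), which is negligible against
   q as soon as e^3 is of order (ln (2/q) / d) ln (d / ln (2/q)). *)
Require Import Defs.
From mathcomp Require Import all_boot all_order all_algebra.
From mathcomp Require Import all_classical all_reals all_analysis.
From mathcomp Require Import ring lra.

Import Order.TTheory GRing.Theory Num.Theory.
Local Open Scope classical_set_scope.
Local Open Scope ring_scope.

(** * Walsh analysis and product noise on the cube *)

Section CubeFourier.
Context {R : realType} {d : nat}.
Local Notation cube := {ffun 'I_d -> bool}.
Implicit Types (x y z S T : cube) (g : cube -> R) (eta : R).

Definition xor_cube x z : cube := [ffun i => x i (+) z i].

Definition weight z : nat := (\sum_i z i)%N.

Definition walsh S z : R := \prod_i (-1) ^+ (S i && z i).

Definition noise eta z : R := \prod_i (if z i then eta else 1 - eta).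

(** Bochner's form of positive definiteness: the Walsh functions are the characters of the group,
    and products and noise averages can be read off the coefficients [w]. *)
Definition positive_definite g : Prop :=
  exists2 w : cube -> R, (forall S, 0 <= w S) &
    forall z, g z = \sum_S w S * walsh S z.

Lemma xor_cubeK x : involutive (xor_cube x).
Proof. by move=> z; apply/ffunP => i; rewrite !ffunE addKb. Qed.

Lemma hamming_xor x z : hamming x (xor_cube x z) = weight z.
Proof.
rewrite /hamming /weight -sum1dep_card big_mkcond.
by apply: eq_bigr => i _; rewrite ffunE; case: (x i); case: (z i).
Qed.

Lemma walshC S z : walsh S z = walsh z S.
Proof. by apply: eq_bigr => i _; rewrite andbC. Qed.

Lemma walsh_xor S T z : walsh (xor_cube S T) z = walsh S z * walsh T z.
Proof.
rewrite -big_split; apply: eq_bigr => i _ /=; rewrite ffunE.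
by case: (S i); case: (T i); case: (z i);
  rewrite /= ?expr0 ?expr1 ?mulr1 ?mul1r ?mulrNN ?mulr1.
Qed.

Lemma sum_prod_cube (F : 'I_d -> bool -> R) :
  \sum_(z : cube) \prod_i F i (z i) = \prod_i (F i true + F i false).
Proof.
rewrite -(bigA_distr_bigA F).
by apply: eq_bigr => i _; rewrite big_bool.
Qed.

Lemma sum_walsh z : \sum_S walsh S z = 2 ^+ d * (z == [ffun=> false])%:R.
Proof.
rewrite (sum_prod_cube (fun i b => (-1) ^+ (b && z i))).
case: eqVneq => [->|/eqP zN0].
  rewrite mulr1 -[d in 2 ^+ d](card_ord d) -prodr_const.
  by apply: eq_bigr => i _; rewrite ffunE /=; ring.
have [i zi] : exists i, z i.
  apply/existsP; apply: contra_notT zN0 => /existsPn zN0.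
  by apply/ffunP => i; rewrite ffunE; apply/negbTE.
by rewrite mulr0 (bigD1 i) //= zi /= expr1 addNr mul0r.
Qed.

Lemma noise_ge0 eta z : 0 <= eta <= 1 -> 0 <= noise eta z.
Proof. by move=> /andP[? ?]; apply: prodr_ge0 => i _; case: ifP => _; lra. Qed.

Lemma sum_noise eta : \sum_z noise eta z = 1.
Proof.
rewrite (sum_prod_cube (fun _ b => if b then eta else 1 - eta)) big1 // => i _.
by ring.
Qed.

(** The bits are independent, and each coordinate of [S] contributes the mean [1 - 2 * eta] of a
    random sign. *)
Lemma noise_walsh eta S :
  \sum_z noise eta z * walsh S z = (1 - 2 * eta) ^+ weight S.
Proof.
under eq_bigr do rewrite -big_split /=.
rewrite (sum_prod_cube (fun i b => (if b then eta else 1 - eta) *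
   (-1) ^+ (S i && b))) expr_sum.
by apply: eq_bigr => i _; case: (S i) => /=; ring.
Qed.

Lemma noise_mgf eta (a : R) :
  \sum_z noise eta z * a ^+ weight z = (1 - eta + eta * a) ^+ d.
Proof.
under eq_bigr do rewrite /weight expr_sum -big_split /=.
rewrite (sum_prod_cube (fun i (b : bool) => (if b then eta else 1 - eta) * a ^+ b)).
rewrite -[d in RHS](card_ord d) -prodr_const.
by apply: eq_bigr => i _; rewrite expr0 expr1; ring.
Qed.

(** Walsh functions multiply by adding their indices, so the coefficients of a product are a
    convolution of nonnegative functions. *)
Lemma positive_definite_mul g g' :
  positive_definite g -> positive_definite g' ->
  positive_definite (fun z => g z * g' z).
Proof.
move=> [w w0 gE] [w' w'0 g'E].
exists (fun U => \sum_S w S * w' (xor_cube S U)).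
  by move=> U; apply: sumr_ge0 => S _; apply: mulr_ge0.
move=> z; under [RHS]eq_bigr do rewrite mulr_suml.
rewrite gE g'E exchange_big mulr_suml /=; apply: eq_bigr => S _.
rewrite [RHS](reindex_inj (inv_inj (xor_cubeK S))) mulr_sumr /=.
by apply: eq_bigr => T _; rewrite xor_cubeK walsh_xor; ring.
Qed.

Lemma positive_definite_exp g m :
  positive_definite g -> positive_definite (fun z => g z ^+ m).
Proof.
move=> gpd; elim: m => [|m IHm].
  exists (fun S => (S == [ffun=> false])%:R) => // z.
  rewrite expr0 (bigD1 [ffun=> false]) //= eqxx mul1r.
  rewrite [X in _ + X]big1 ?addr0; last by move=> S /negbTE ->; rewrite mul0r.
  by rewrite /walsh big1 // => i _; rewrite ffunE expr0.
have [w w0 wE] := positive_definite_mul _ _ gpd IHm.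
by exists w => // z; rewrite exprS wE.
Qed.

Lemma walsh_inversion g z :
  g z = \sum_S ((2 ^+ d)^-1 * \sum_y g y * walsh S y) * walsh S z.
Proof.
under eq_bigr do rewrite -mulrA mulr_suml.
rewrite -mulr_sumr exchange_big /=.
transitivity ((2 ^+ d)^-1 * \sum_y g y * (2 ^+ d * (y == z)%:R)).
  rewrite (bigD1 z) //= eqxx mulr1 big1 ?addr0; last first.
    by move=> y /negbTE ->; rewrite !mulr0.
  by rewrite mulrCA mulVf ?mulr1// expf_neq0 // pnatr_eq0.
congr (_ * _); apply: eq_bigr => y _.
(* Since [y = z] means [y + z = 0], [sum_walsh] turns the indicator into a full character sum. *)
have -> : (y == z) = (xor_cube y z == [ffun=> false]).
  apply/eqP/eqP => [->|/ffunP yz]; apply/ffunP => i; first by rewrite !ffunE addbb.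
  by move: (yz i); rewrite !ffunE; case: (y i); case: (z i).
rewrite -sum_walsh mulr_sumr; apply: eq_bigr => S _.
by rewrite walshC walsh_xor !(walshC S); ring.
Qed.

Definition translation_average (k : cube -> cube -> R) z : R :=
  (2 ^+ d)^-1 * \sum_x k x (xor_cube x z).

(** The coefficient at [S] is, up to a positive factor, the quadratic form of [k] at the vector
    [walsh S]. *)
Lemma translation_average_positive_definite (k : cube -> cube -> R) :
  (forall a : cube -> R, 0 <= \sum_x \sum_y a x * a y * k x y) ->
  positive_definite (translation_average k).
Proof.
move=> kpsd; have c0 : 0 <= (2 ^+ d)^-1 :> R by rewrite invr_ge0 exprn_ge0.
exists (fun S => (2 ^+ d)^-1 * \sum_y translation_average k y * walsh S y);
  last by move=> z; exact: walsh_inversion.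
move=> S; apply: mulr_ge0 => //.
under eq_bigr do rewrite -mulrA.
rewrite -mulr_sumr; apply: mulr_ge0 => //.
under eq_bigr do rewrite mulr_suml.
rewrite exchange_big /=.
apply: le_trans (kpsd (walsh S)) _.
rewrite le_eqVlt; apply/orP; left; apply/eqP/eq_bigr => x _.
rewrite [RHS](reindex_inj (inv_inj (xor_cubeK x))) /=.
apply: eq_bigr => y _; rewrite xor_cubeK (walshC S (xor_cube x y)) walsh_xor.
by rewrite !(walshC S) mulrC.
Qed.

Lemma translation_average_ge (k : cube -> cube -> R) z a :
  (forall x, a <= k x (xor_cube x z)) -> a <= translation_average k z.
Proof.
move=> ak; rewrite /translation_average mulrC ler_pdivlMr ?exprn_gt0//.
have -> : a * 2 ^+ d = \sum_(x : cube) a.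
  by rewrite sumr_const card_ffun card_bool card_ord -natrX mulr_natr.
by apply: ler_sum => x _.
Qed.

Lemma translation_average_le (k : cube -> cube -> R) z a :
  (forall x, k x (xor_cube x z) <= a) -> translation_average k z <= a.
Proof.
move=> ak; rewrite /translation_average mulrC ler_pdivrMr ?exprn_gt0//.
have -> : a * 2 ^+ d = \sum_(x : cube) a.
  by rewrite sumr_const card_ffun card_bool card_ord -natrX mulr_natr.
by apply: ler_sum => x _.
Qed.

End CubeFourier.

(** * Positive semidefiniteness of collision probabilities *)

Section CollisionKernel.
Context {R : realType}.

(** Having equal hash values is an equivalence relation, and the form is a sum of squares, one for
    each class. *)
Lemma equality_kernel_psd (T : finType) (U : Type) (h : T -> U) (a : T -> R) :
  0 <= \sum_x \sum_y a x * a y * (`[< h x = h y >])%:R.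
Proof.
(* One element is chosen in each fibre of [h], so that classes are indexed by the finite [T] instead
   of [U]. The default is never taken, as [x] lies in its own fibre. *)
pose rep x := odflt x [pick y | `[< h y = h x >]].
have hrep x : h (rep x) = h x.
  by rewrite /rep; case: pickP => //= y /asboolP.
have repE x y : `[< h x = h y >] = (rep x == rep y).
  apply/asboolP/eqP => [hxy|rxy]; last by rewrite -hrep rxy hrep.
  rewrite /rep hxy; case: pickP => //= /(_ y).
  by move/asboolP; case.
rewrite (_ : \sum_x _ = \sum_v (\sum_x a x * (rep x == v)%:R) ^+ 2).
  by apply: sumr_ge0 => v _; exact: sqr_ge0.
under [RHS]eq_bigr do rewrite expr2 mulr_suml.
rewrite [RHS]exchange_big /=; apply: eq_bigr => x _.
under [RHS]eq_bigr do rewrite mulr_sumr.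
rewrite [RHS]exchange_big /=; apply: eq_bigr => y _.
rewrite (bigD1 (rep x)) //= eqxx big1 => [|v /negbTE vx]; last first.
  by rewrite (eq_sym (rep x)) vx mulr0 mul0r.
by rewrite repE (eq_sym (rep y)) mulr1 addr0 mulrA.
Qed.

Context {X : distanceSpace R} {U : pointedType}.

(** The event is a union, over the countably many common values, of intersections of two
    cylinders. *)
Lemma measurable_collision (x y : X) : countable [set: U] ->
  measurable ([set h | h x = h y] : set (hash_function X U)).
Proof.
move=> Ucount.
have -> : [set h : X -> U | h x = h y] =
    \bigcup_(u in [set: U]) ([set h | h x = u] `&` [set h | h y = u]).
  apply/seteqP; split=> h /=; first by move=> hxy; exists (h x).
  by case=> u _ [/= -> ->].
apply: countable_bigcupT_measurable => // u.
by apply: measurableI; apply: sub_sigma_algebra; [exists x, u|exists y, u].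
Qed.

(** For each fixed hash function the form is that of an equality kernel; integrating over [H] keeps
    its sign. *)
Lemma collision_prob_psd (T : finType) (x : T -> X) (H : hash_family X U)
    (a : T -> R) : countable [set: U] ->
  0 <= \sum_i \sum_j a i * a j * fine (collision_prob H (x i) (x j)).
Proof.
move=> Ucount.
pose A i j : set (hash_function X U) := [set h | h (x i) = h (x j)].
have mA i j : measurable (A i j) by exact: measurable_collision.
have iA i j : H.-integrable setT (fun h => (a i * a j)%:E * (\1_(A i j) h)%:E)%E.
  by apply: integrableZl => //; exact: integrable_indic.
rewrite -lee_fin.
have -> : (\sum_i \sum_j a i * a j * fine (collision_prob H (x i) (x j)))%:E =
    (\int[H]_h \sum_i \sum_j (a i * a j)%:E * (\1_(A i j) h)%:E)%E.
  rewrite integral_sum //; last by move=> i; exact: integrable_sum.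
  rewrite -sumEFin; apply: eq_bigr => i _.
  rewrite integral_sum // -sumEFin; apply: eq_bigr => j _.
  rewrite integralZl//; last exact: integrable_indic.
  rewrite integral_indic// setIT EFinM fineK//.
  by rewrite /collision_prob fin_num_measure //; exact: mA.
apply: integral_ge0 => h _.
under eq_bigr do under eq_bigr do rewrite -EFinM.
under eq_bigr do rewrite sumEFin.
rewrite sumEFin lee_fin.
apply: le_trans (equality_kernel_psd _ _ (h \o x) a) _.
rewrite le_eqVlt; apply/orP; left; apply/eqP.
apply: eq_bigr => i _; apply: eq_bigr => j _; by congr (_ * _%:R).
Qed.

End CollisionKernel.

(** * Elementary estimates for the exponential and the logarithm *)

Section ExponentialBounds.
Context {R : realType}.
Implicit Types x y a : R.

(** Bound [expR x] by [1 / (1 - x)]; clearing the denominator leaves [0 <= x ^+ 2 * (1 - 2 * x)]. *)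
Lemma expR_le_quadratic x : x <= 1 / 2 -> expR x <= 1 + x + 2 * x ^+ 2.
Proof.
move=> x2; have x1 : 0 < 1 - x by lra.
apply: (@le_trans _ _ (1 - x)^-1).
  have := expR_ge1Dx (- x); rewrite expRN => e.
  by rewrite -[expR x]invrK lef_pV2 ?posrE ?invr_gt0 ?expR_gt0.
rewrite -div1r ler_pdivrMr//.
have : 0 <= x ^+ 2 * (1 - 2 * x) by apply: mulr_ge0; [exact: sqr_ge0|lra].
by nra.
Qed.

(** Convexity: the tangent at [a * y] bounds [expR y] and [expR 0] from below. With weights [a] and
    [1 - a] the linear terms cancel. *)
Lemma expR_chord a y : 0 <= a <= 1 -> expR (a * y) <= 1 + a * (expR y - 1).
Proof.
move=> /andP[a0 a1]; have ea : 0 < expR (a * y) := expR_gt0 _.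
have h1 : expR (a * y) * (1 + (1 - a) * y) <= expR y.
  have -> : expR y = expR (a * y) * expR ((1 - a) * y).
    by rewrite -expRD; congr expR; ring.
  apply: ler_wpM2l; first exact: ltW.
  apply: le_trans (expR_ge1Dx _); lra.
have h2 : expR (a * y) * (1 - a * y) <= 1.
  rewrite -[leRHS](expRxMexpNx_1 (a * y)); apply: ler_wpM2l; first exact: ltW.
  exact: expR_ge1Dx.
by nra.
Qed.

Lemma ln2_ge_half : 1 / 2 <= ln 2 :> R.
Proof.
have : ln (1 + - (1 / 2)) <= - (1 / 2) :> R by apply: le_ln1Dx; lra.
have -> : 1 + - (1 / 2) = 2^-1 :> R by field.
by rewrite lnV ?posrE//; lra.
Qed.

Lemma ln_1B_ge x : 0 <= x <= 1 / 2 -> - (2 * x) <= ln (1 - x).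
Proof.
move=> /andP[x0 x2]; rewrite -ler_expR lnK ?posrE; last lra.
have := @expR_le_quadratic (- (2 * x)); have := sqr_ge0 x.
have : 0 < expR (2 * x) := expR_gt0 _; have := expR_ge1Dx (2 * x).
rewrite expRN => h e _ _.
rewrite -div1r ler_pdivrMr//; nra.
Qed.

End ExponentialBounds.

(** * Noise stability: tail bounds and interpolation in time *)

Section NoiseStability.
Context {R : realType} {d : nat}.
Local Notation cube := {ffun 'I_d -> bool}.
Implicit Types (z : cube) (g : cube -> R).

(** Exponential Markov inequality; the sign of [theta] decides between upper and lower tails. *)
Lemma noise_chernoff (eta theta tau : R) (P : pred cube) : 0 <= eta <= 1 ->
  (forall z, P z -> theta * (tau * d%:R) <= theta * (weight z)%:R) ->
  \sum_(z | P z) noise eta z <=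
    expR (d%:R * (eta * (expR theta - 1) - theta * tau)).
Proof.
move=> eta01 Pz; have /andP[eta0 eta1] := eta01.
pose e z := expR (theta * (weight z)%:R - theta * (tau * d%:R)).
apply: (@le_trans _ _ (\sum_z noise eta z * e z)).
  rewrite big_mkcond /=; apply: ler_sum => z _.
  have nz := noise_ge0 eta z eta01.
  case: ifPn => [/Pz h|_]; last by rewrite mulr_ge0 ?expR_ge0.
  by rewrite ler_peMr// /e -[leLHS]expR0 ler_expR subr_ge0.
under eq_bigr do rewrite /e expRD expRM_natr mulrA.
rewrite -mulr_suml noise_mgf.
have -> : d%:R * (eta * (expR theta - 1) - theta * tau) =
  (eta * (expR theta - 1)) * d%:R - theta * (tau * d%:R) by ring.
rewrite expRD expRM_natr ler_wpM2r ?expR_ge0// lerXn2r ?nnegrE ?expR_ge0//.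
  have := expR_ge0 theta; nra.
by apply: le_trans (expR_ge1Dx _); lra.
Qed.

(** The flip rate satisfies [1 - 2 * eta = expR (- s)], which makes [s] the time of the noise
    semigroup, evaluated here at the origin. *)
Definition stability g (s : R) : R :=
  \sum_z noise ((1 - expR (- s)) / 2) z * g z.

Lemma stability_walsh (w g : cube -> R) (s : R) :
  (forall z, g z = \sum_S w S * walsh S z) ->
  stability g s = \sum_S w S * expR (- s * (weight S)%:R).
Proof.
move=> gE; rewrite /stability.
under eq_bigr do rewrite gE mulr_sumr.
rewrite exchange_big /=; apply: eq_bigr => S _.
under eq_bigr do rewrite mulrCA.
rewrite -mulr_sumr noise_walsh expRM_natr; congr (_ * _ ^+ _).
by field.
Qed.

(** The coefficients [w] sum to 1, so this is Jensen's inequality for the power [a]. Each term is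
    normalised by [expR v] and bounded by [expR_chord]; the sum leaves the factor
    [1 - a + a * expR (- v) * W], at most 1. *)
Lemma stability_interpolation g (s a v : R) :
  positive_definite g -> g [ffun=> false] = 1 -> 0 <= a <= 1 ->
  stability g s <= expR v -> stability g (a * s) <= expR (a * v).
Proof.
move=> [w w0 gE] g1 a01; rewrite !(stability_walsh _ _ _ gE) => sv.
have w1 : \sum_S w S = 1.
  rewrite -g1 gE; apply: eq_bigr => S _.
  by rewrite /walsh big1 ?mulr1// => i _; rewrite ffunE andbF expr0.
pose W := \sum_S w S * expR (- s * (weight S)%:R).
apply: (@le_trans _ _ (\sum_S expR (a * v) *
    ((1 - a) * w S + a * expR (- v) * (w S * expR (- s * (weight S)%:R))))).
  apply: ler_sum => S _.
  have -> : - (a * s) * (weight S)%:R =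
    a * v + a * (- s * (weight S)%:R + - v) by ring.
  rewrite expRD mulrCA ler_wpM2l ?expR_ge0//.
  have := ler_wpM2l (w0 S) (expR_chord a (- s * (weight S)%:R + - v) a01).
  rewrite expRD => /le_trans; apply.
  by rewrite le_eqVlt; apply/orP; left; apply/eqP; ring.
rewrite -mulr_sumr big_split /= -!mulr_sumr w1 ler_piMr ?expR_ge0//.
have : expR (- v) * W <= 1.
  rewrite -[leRHS](expRxMexpNx_1 v) mulrC ler_wpM2r ?expR_ge0//.
rewrite -/W -mulrA; move: (expR _ * W) => y; case/andP: a01; nra.
Qed.

End NoiseStability.

(** * Sensitive positive definite functions on the cube *)

Section SensitiveFunctions.
Context {R : realType}.
Implicit Types c e q : R.

(* The far radius c * near_radius c e is the mean relative weight of the noise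
   at time e, lowered by the deviation e^2 allowed in the Chernoff bound. *)
Definition near_radius c e : R := ((1 - expR (- e)) / 2 - e ^+ 2) / c.

Lemma flip_rate_bounds e : 0 <= e <= 1 / 2 ->
  e / 2 - e ^+ 2 <= (1 - expR (- e)) / 2 <= e / 2.
Proof.
move=> /andP[e0 e2]; have := expR_ge1Dx (- e).
have /expR_le_quadratic : - e <= 1 / 2 by lra.
by rewrite sqrrN => ? ?; apply/andP; split; lra.
Qed.

(** The last bound is on the ratio of the near noise time to the far time [e]. Its loss is
    [4 * e / c] from the far flip rate and deviation, plus [2 * e] from the near deviation. *)
Lemma near_radius_bounds c e : 1 < c -> 0 < e -> 9 * e < 1 / c ->
  [/\ e ^+ 2 <= near_radius c e, near_radius c e <= e / 2,
    c * near_radius c e = (1 - expR (- e)) / 2 - e ^+ 2 &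
    1 / c - 6 * e <= 2 * (near_radius c e - e ^+ 2) / e].
Proof.
move=> c1 e0 ec; have c0 : 0 < c by lra.
have i0 : 0 < c^-1 by rewrite invr_gt0.
have i1 : c^-1 < 1 by rewrite invf_lt1.
rewrite div1r in ec *.
have /flip_rate_bounds/andP[] : 0 <= e <= 1 / 2 by apply/andP; split; lra.
rewrite /near_radius; set eta := (1 - _) / 2 => eta1 eta2.
have e2 : 0 < e ^+ 2 by rewrite exprn_gt0.
split.
- rewrite ler_pdivlMr//.
  have : 9 * e * c < 1 by rewrite -ltr_pdivlMr// div1r.
  have ee : e ^+ 2 <= e / 9 by rewrite expr2 ler_wpM2l ?ltW//; lra.
  move=> /ltW/(ler_wpM2l (ltW e0)); rewrite mulr1.
  have -> : e * (9 * e * c) = 9 * (e ^+ 2 * c) by ring.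
  lra.
- rewrite ler_pdivrMr//; nra.
- by field; rewrite gt_eqF.
- rewrite ler_pdivlMr// -/(c^-1); set u := c^-1 in i0 i1 ec *.
  have : (e / 2 - e ^+ 2 - e ^+ 2) * u <= (eta - e ^+ 2) * u.
    by apply: ler_wpM2r; [exact: ltW|lra].
  nra.
Qed.

Context {d : nat}.
Local Notation cube := {ffun 'I_d -> bool}.
Implicit Types (z : cube) (g : cube -> R).

(** Beyond the far radius [g] is at most [Q]; the lighter points have noise mass at most [e * Q],
    and there [g <= 1] suffices. *)
Lemma far_stability_le g c e Q : 1 < c -> 0 < e -> 9 * e < 1 / c -> 0 <= Q ->
  (forall z, 0 <= g z <= 1) ->
  (forall z, c * near_radius c e * d%:R <= (weight z)%:R -> g z <= Q) ->
  expR (- (d%:R * (e ^+ 3 / 4))) <= e * Q ->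
  stability g e <= Q * (1 + e).
Proof.
move=> c1 e0 ec Q0 g01 gQ tail.
have [_ _ cr _] := near_radius_bounds c e c1 e0 ec.
have ic : 1 / c < 1 by rewrite div1r invf_lt1//; lra.
have /flip_rate_bounds/andP[] : 0 <= e <= 1 / 2 by apply/andP; split; lra.
rewrite /stability; rewrite cr in gQ; set eta := (1 - _) / 2 in gQ * => eta1 eta2.
have eta01 : 0 <= eta <= 1 by rewrite expr2 in eta1; apply/andP; split; nra.
have nz z : 0 <= noise eta z := noise_ge0 eta z eta01.
pose P := [pred z : cube | (weight z)%:R < (eta - e ^+ 2) * d%:R].
apply: (@le_trans _ _ (Q + \sum_(z | P z) noise eta z)).
  rewrite -[Q]mul1r -(@sum_noise R d eta) mulr_suml [X in _ + X]big_mkcond -big_split.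
  apply: ler_sum => z _ /=; case: ifPn => [_|].
    by have /andP[? ?] := g01 z; have := nz z; nra.
  by rewrite -leNgt => /gQ gz; rewrite addr0 ler_wpM2l.
rewrite mulrDr mulr1 lerD2l (mulrC Q); apply: le_trans tail.
(* The quadratic bound on [expR] and [eta <= e / 2] give the exponent
   [e * theta ^+ 2 + theta * e ^+ 2], minimal at [theta = - (e / 2)] with value [- e ^+ 3 / 4]. *)
apply: le_trans (noise_chernoff eta (- (e / 2)) (eta - e ^+ 2) _ eta01 _) _.
  by move=> z /ltW Pz; rewrite ler_wnM2l// oppr_le0; lra.
rewrite ler_expR -(mulrN d%:R) ler_wpM2l//.
have /expR_le_quadratic : - (e / 2) <= 1 / 2 by lra.
move=> h; have /andP[eta00 _] := eta01.
have := ler_wpM2l eta00 h.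
have : 0 <= e ^+ 2 * (e / 2 - eta) by apply: mulr_ge0; [exact: sqr_ge0|lra].
by nra.
Qed.

(** At this time the flip rate is at most [near_radius c e - e ^+ 2], so leaving the near ball
    requires an upward deviation of at least [e ^+ 2]. *)
Lemma near_stability_ge g c e P : 1 < c -> 0 < e -> 9 * e < 1 / c -> 0 <= P ->
  (forall z, 0 <= g z) ->
  (forall z, (weight z)%:R <= near_radius c e * d%:R -> P <= g z) ->
  expR (- (d%:R * (e ^+ 3 / 4))) <= e ->
  P * (1 - e) <= stability g (2 * (near_radius c e - e ^+ 2)).
Proof.
move=> c1 e0 ec P0 g0 gP tail.
have [r1 r2 _ _] := near_radius_bounds c e c1 e0 ec.
have ic : 1 / c < 1 by rewrite div1r invf_lt1//; lra.
set r := near_radius c e in gP r1 r2 *.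
have /flip_rate_bounds/andP[] : 0 <= 2 * (r - e ^+ 2) <= 1 / 2.
  by have e2 := sqr_ge0 e; apply/andP; split; lra.
rewrite /stability => _; set eta := (1 - _) / 2 => eta2.
have eta0 : 0 <= eta.
  by rewrite divr_ge0// subr_ge0 expR_le1; lra.
have eta01 : 0 <= eta <= 1 by have e2 := sqr_ge0 e; apply/andP; split; lra.
have nz z : 0 <= noise eta z := noise_ge0 eta z eta01.
pose F := [pred z : cube | r * d%:R < (weight z)%:R].
apply: (@le_trans _ _ (P * (1 - \sum_(z | F z) noise eta z))); last first.
  rewrite -(@sum_noise R d eta) [X in _ - X]big_mkcond -sumrB mulr_sumr.
  apply: ler_sum => z _ /=; case: ifPn => [_|].
    by rewrite subrr mulr0 mulr_ge0.
  by rewrite -leNgt => /gP gz; rewrite subr0 mulrC ler_wpM2l.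
rewrite ler_wpM2l// lerB//; apply: le_trans tail.
apply: le_trans (noise_chernoff eta (e / 2) r _ eta01 _) _.
  by move=> z /ltW Pz; rewrite ler_wpM2l//; lra.
rewrite ler_expR -(mulrN d%:R) ler_wpM2l//.
have /expR_le_quadratic : e / 2 <= 1 / 2 by lra.
have := expR_ge1Dx (e / 2) => h1 h2.
have h3 : 0 <= expR (e / 2) - 1 by lra.
have h4 : eta <= r - e ^+ 2 by lra.
have := ler_wpM2r h3 h4.
have : (r - e ^+ 2) * (expR (e / 2) - 1) <= (r - e ^+ 2) * (e / 2 + 2 * (e / 2) ^+ 2).
  by rewrite ler_wpM2l//; lra.
have : 0 <= e ^+ 2 * (e / 2 - r) by apply: mulr_ge0; [exact: sqr_ge0|lra].
have : 0 <= e ^+ 4 by rewrite exprn_even_ge0.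
by nra.
Qed.

(** Interpolation between times 0 and [e] gives [P * (1 - e) <= (Q * (1 + e)) ^ a] with
    [a >= 1 / c - 6 * e]. After logarithms the factors [1 - e] and [1 + e] cost at most [3 * e],
    absorbed because [ln Q <= -1]. *)
Lemma sensitive_function_ln_le g c e P Q : 1 < c -> 0 < e -> 9 * e < 1 / c ->
  0 < P -> 0 < Q <= expR (-1) ->
  positive_definite g -> g [ffun=> false] = 1 -> (forall z, 0 <= g z <= 1) ->
  (forall z, (weight z)%:R <= near_radius c e * d%:R -> P <= g z) ->
  (forall z, c * near_radius c e * d%:R <= (weight z)%:R -> g z <= Q) ->
  expR (- (d%:R * (e ^+ 3 / 4))) <= e * Q ->
  ln P <= (1 / c - 9 * e) * ln Q.
Proof.
move=> c1 e0 ec P0 /andP[Q0 Q1] gpd g1 g01 gP gQ tail.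
have ic : 1 / c < 1 by rewrite div1r invf_lt1//; lra.
have lnQ : ln Q <= -1 by rewrite -ler_expR lnK.
have Q1' : Q <= 1 by apply: le_trans Q1 _; rewrite expR_le1; lra.
have tail1 : expR (- (d%:R * (e ^+ 3 / 4))) <= e.
  by apply: le_trans tail _; rewrite ler_piMr// ltW.
have far := far_stability_le g c e Q c1 e0 ec (ltW Q0) g01 gQ tail.
have g0 z : 0 <= g z by have /andP[] := g01 z.
have near := near_stability_ge g c e P c1 e0 ec (ltW P0) g0 gP tail1.
have [r1 r2 _ r3] := near_radius_bounds c e c1 e0 ec.
move: near r1 r2 r3; set r := near_radius c e => near r1 r2 r3.
set a := 2 * (r - e ^+ 2) / e in r3.
have a01 : 0 <= a <= 1.
  apply/andP; split; first by rewrite divr_ge0 ?(ltW e0)// mulr_ge0// subr_ge0.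
  by rewrite ler_pdivrMr//; have := sqr_ge0 e; lra.
have ae : a * e = 2 * (r - e ^+ 2) by rewrite mulfVK// gt_eqF.
have V0 : 0 < Q * (1 + e) by rewrite mulr_gt0//; lra.
rewrite -[Q * (1 + e)]lnK// in far.
have := stability_interpolation g e a _ gpd g1 a01 far.
rewrite ae => /(le_trans near); rewrite -[P * (1 - e)]lnK ?posrE; last first.
  by rewrite mulr_gt0//; lra.
rewrite ler_expR !lnM ?posrE//; try lra.
have : ln (1 + e) <= e by apply: le_ln1Dx; lra.
have : - (2 * e) <= ln (1 - e) by apply: ln_1B_ge; apply/andP; split; lra.
case/andP: a01 => a0 a1 h1 h2 h3.
have : a * ln (1 + e) <= e by nra.
nra.
Qed.

End SensitiveFunctions.

(** * Hash families: range of the parameters and the mean collision function *)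

Lemma sensitive_p_le1 (R : realType) (X : distanceSpace R) (U : pointedType)
    (r s p q : R) (H : hash_family X U) (x : X) :
  0 <= r -> sensitive r s p q H -> p <= 1.
Proof.
move=> r0 [_ near _].
have : dist x x <= r by rewrite (proj2 (dist_eq0 x x)).
move=> /near; rewrite /collision_prob.
have -> : [set h : X -> U | h x = h x] = setT by apply/seteqP; split.
by rewrite probability_setT lee_fin.
Qed.

Lemma rho_ge0 (R : realType) (p q : R) : 0 < p <= 1 -> 0 < q < 1 -> 0 <= rho p q.
Proof.
move=> /andP[p0 p1] /andP[q0 q1]; rewrite /rho !div1r; apply: divr_ge0.
  by rewrite lnV ?posrE// oppr_ge0 ln_le0.
by rewrite lnV ?posrE// oppr_ge0 ln_le0 // ltW.
Qed.

Section CubeHashFamily.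
Context {R : realType} {d : nat} {U : pointedType}.
Local Notation cube := {ffun 'I_d -> bool}.
Context (H : hash_family (hamming_cube R d) U).
Context (U_countable : countable [set: U]).

Definition mean_collision : cube -> R :=
  translation_average (fun x y => fine (collision_prob H x y)).

Let mU (x y : hamming_cube R d) := measurable_collision x y U_countable.

Lemma collision_prob_fin (x y : hamming_cube R d) :
  collision_prob H x y \is a fin_num.
Proof. by rewrite /collision_prob fin_num_measure//; exact: mU. Qed.

Lemma mean_collision_pd : positive_definite mean_collision.
Proof.
apply: translation_average_positive_definite => a.
exact: (collision_prob_psd _ (fun x : cube => x : hamming_cube R d)).
Qed.

Lemma mean_collision_in01 z : 0 <= mean_collision z <= 1.
Proof.
apply/andP; split.
  by apply: translation_average_ge => x; rewrite fine_ge0// measure_ge0.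
apply: translation_average_le => x.
rewrite -lee_fin fineK ?collision_prob_fin//.
by rewrite /collision_prob probability_le1//; exact: mU.
Qed.

Lemma mean_collision0 : mean_collision [ffun=> false] = 1.
Proof.
apply/eqP; rewrite eq_le; have /andP[_ ->] := mean_collision_in01 [ffun=> false].
apply: translation_average_ge => x.
have -> : xor_cube x [ffun=> false] = x.
  by apply/ffunP => i; rewrite !ffunE addbF.
rewrite /collision_prob.
have -> : [set h : hamming_cube R d -> U | h x = h x] = setT.
  by apply/seteqP; split.
by rewrite probability_setT.
Qed.

(** All pairs averaged at [z] lie at the same distance [weight z], so a bound valid for each pair
    passes to the mean. *)
Lemma mean_collision_sensitive (r s p q : R) z : sensitive r s p q H ->
  ((weight z)%:R <= r -> p <= mean_collision z) /\
  (s <= (weight z)%:R -> mean_collision z <= q).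
Proof.
move=> [_ near far]; split=> wz.
  apply: translation_average_ge => x.
  rewrite -lee_fin fineK ?collision_prob_fin//.
  by apply: near; rewrite /= hamming_xor.
apply: translation_average_le => x.
rewrite -lee_fin fineK ?collision_prob_fin//.
by apply: far; rewrite /= hamming_xor.
Qed.

(* Passing to an m-th power of the collision function (concatenating m
   independent hashes) leaves rho unchanged, and lets q be bounded away from 1. *)
Lemma rho_lower_bound (c e p q : R) (m : nat) :
  1 < c -> 0 < e -> 9 * e < 1 / c -> 0 < q < 1 ->
  1 <= - ln q *+ m -> - ln q *+ m - ln e <= d%:R * (e ^+ 3 / 4) ->
  sensitive (near_radius c e * d%:R) (c * near_radius c e * d%:R) p q H ->
  1 / c - 9 * e <= rho p q.
Proof.
move=> c1 e0 ec /andP[q0 q1] qm de Hs.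
have pq : q < p by case: Hs.
have p0 := lt_trans q0 pq.
have lq : 0 < - ln q by rewrite oppr_gt0 ln_lt0// q0.
have m0 : 0 < m%:R :> R.
  by rewrite ltr0n lt0n; apply: contraTN qm => /eqP ->; rewrite mulr0n -ltNge.
rewrite mulNrn -lnXn// in qm de.
have Qm : 0 < q ^+ m by rewrite exprn_gt0.
pose g z := mean_collision z ^+ m.
have g01 z : 0 <= g z <= 1.
  have /andP[k0 k1] := mean_collision_in01 z.
  by rewrite exprn_ge0// exprn_ile1.
have := @sensitive_function_ln_le R d g c e (p ^+ m) (q ^+ m) c1 e0 ec.
rewrite !lnXn// /rho !div1r !lnV ?posrE// => main.
have {}main : ln p *+ m <= (1 / c - 9 * e) * (ln q *+ m).
  rewrite div1r; apply: main => //.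
  - by rewrite exprn_gt0.
  - by rewrite Qm /= -ler_ln ?posrE ?expR_gt0// expRK; lra.
  - by apply: positive_definite_exp; exact: mean_collision_pd.
  - by rewrite /g mean_collision0 expr1n.
  - move=> z /(mean_collision_sensitive _ _ _ _ z Hs).1 pz.
    by rewrite lerXn2r ?nnegrE ?(ltW p0)//; apply: le_trans pz; exact: ltW.
  - move=> z /(mean_collision_sensitive _ _ _ _ z Hs).2 qz.
    have /andP[k0 _] := mean_collision_in01 z.
    by rewrite lerXn2r ?nnegrE ?(ltW q0).
  (* The hypothesis [de] is the tail condition in logarithmic form. *)
  - rewrite -[leRHS]lnK ?posrE ?mulr_gt0// ler_expR lnM ?posrE//; lra.
rewrite -(mulr_natr (ln p)) -(mulr_natr (ln q)) mulrA ler_pM2r// div1r in main.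
by rewrite ler_pdivlMr// mulrN lerN2.
Qed.

End CubeHashFamily.

(** * Choice of the power, of the noise time and of the constant *)

Lemma exists_power (R : realType) (q : R) : 0 < q < 1 ->
  exists m : nat, 1 <= - ln q *+ m <= 2 * ln (2 / q).
Proof.
move=> /andP[q0 q1]; have lq : 0 < - ln q by rewrite oppr_gt0 ln_lt0// q0.
(* Rounding up costs at most one extra [- ln q], and [1 - ln q <= 2 * ln (2 / q)] since
   [ln 2 >= 1 / 2]. *)
exists (Num.truncn (- ln q)^-1).+1.
have /andP[t1 t2] := truncn_itv (ltW (etrans (invr_gt0 _) lq)).
rewrite ln_div ?posrE//; have l2 := @ln2_ge_half R.
rewrite -(mulr_natr (- ln q)); apply/andP; split.
  by rewrite mulrC -ler_pdivrMr// div1r ltW.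
rewrite -addn1 natrD mulrDr mulr1.
have : - ln q * (Num.truncn (- ln q)^-1)%:R <= 1.
  by rewrite mulrC -ler_pdivlMr// div1r.
lra.
Qed.

Theorem theorem3p1 (R : realType) :
  exists K : R, 0 < K /\
  forall (d : nat) (c q : R),
    1 < c -> 0 < q < 1 -> 2 <= d%:R / ln (2 / q) ->
  exists tau : R, 0 < tau < 1 /\
  forall (U : pointedType) (p : R) (H : hash_family (hamming_cube R d) U),
    countable [set: U] ->
    sensitive (tau * d%:R) (c * tau * d%:R) p q H ->
    1 / c - (K * (ln (2 / q) / d%:R) * ln (d%:R / ln (2 / q))) `^ (1 / 3)
      <= rho p q.
Proof.
(* The error term [D] has to be [9 * e], whence [9 ^+ 3]; the factor 27 leaves room for the tail
   condition. *)
have [K [K0 KE]] : exists K : R, 0 < K /\ K = 27 * 9 ^+ 3.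
  by exists (27 * 9 ^+ 3); split; rewrite // mulr_gt0 ?exprn_gt0.
exists K; split=> //.
move=> d c q c1 q01; have /andP[q0 q1] := q01.
set N := ln (2 / q); set L := ln (d%:R / N) => dN.
have l2 := @ln2_ge_half R.
have N2 : 1 / 2 <= N.
  have : ln q < 0 by rewrite ln_lt0.
  by rewrite /N ln_div ?posrE//; lra.
have N0 : 0 < N by lra.
have L2 : 1 / 2 <= L.
  by apply: le_trans l2 _; rewrite ler_ln ?posrE//; lra.
have d0 : 0 < d%:R :> R by move: dN; rewrite ler_pdivlMr//; lra.
set D := (_ `^ _).
pose e := D / 9.
have D0 : 0 < D by rewrite powR_gt0// !mulr_gt0// ?invr_gt0//; lra.
have e0 : 0 < e by rewrite divr_gt0.
have D9 : D = 9 * e by rewrite /e; field.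
have e3 : e ^+ 3 = 27 * (N / d%:R) * L.
  rewrite /e expr_div_n -powR_mulrn ?ltW// -powRrM.
  have -> : 1 / 3 * 3%:R = 1 :> R by field.
  rewrite powRr1; last by rewrite !mulr_ge0 ?invr_ge0//; lra.
  by rewrite KE; field; rewrite gt_eqF.
(* If [1 / c <= D] the lower bound is nonpositive, and [rho_ge0] settles it at the arbitrary radius
   [1 / 2]. *)
have [triv|De] := leP (1 / c) D.
  exists (1 / 2); split; first by apply/andP; split; lra.
  move=> U p H _ Hs; apply: (@le_trans _ _ 0); first by rewrite subr_le0.
  apply: rho_ge0 => //; apply/andP; split; first by case: Hs => pq _ _; lra.
  apply: (sensitive_p_le1 _ _ _ _ _ _ _ H [ffun=> false] _ Hs); rewrite mulr_ge0//; lra.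
rewrite D9 in De *.
have ic : 1 / c < 1 by rewrite div1r invf_lt1//; lra.
have [r1 r2 _ _] := near_radius_bounds c e c1 e0 De.
have ee : 0 < e ^+ 2 by rewrite exprn_gt0.
exists (near_radius c e); split; first by apply/andP; split; lra.
move=> U p H Uc Hs; have [m /andP[m1 m2]] := exists_power R q q01.
apply: (rho_lower_bound H Uc c e p q m) => //.
have -> : d%:R * (e ^+ 3 / 4) = 27 / 4 * (N * L).
  by rewrite e3; field; rewrite gt_eqF.
(* Here [N / d = expR (- L)], so [e ^+ 3 = 27 * L * expR (- L)] with [27 * L >= 1]. *)
have lne : - (L / 3) <= ln e.
  have : ln (e ^+ 3) = ln (27 * L) - L.
    have L0 : 0 < 27 * L by lra.
    rewrite e3 -ln_div ?posrE ?divr_gt0//.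
    by congr ln; field; rewrite !gt_eqF.
  have : 0 <= ln (27 * L) by rewrite ln_ge0//; lra.
  by rewrite lnXn//; lra.
(* It remains to fit [2 * N + L / 3] under [27 / 4 * (N * L)]: as [N] and [L] are at least [1 / 2],
   the two terms are at most 4 and 2/3 times [N * L]. *)
have : 0 <= (N - 1 / 2) * L by rewrite mulr_ge0//; lra.
have : 0 <= N * (L - 1 / 2) by rewrite mulr_ge0//; lra.
rewrite -/N in m2; nra.
Qed.
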